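(* Let $R$ be an infinite ring (with identity) and assume that, for each $m\in\mathbb N$, the set $m\cdot R=\{m\cdot r:r\in R\}$ is central* in $(R,+)$. Let $\alpha\in\mathbb N$ and, for each $n\geq 2$ and $1\leq i\leq\alpha$, let $d_{n,i}\in R$. Then System $( * )$ is strongly centrally partition regular over $R$: whenever $C$ is a central subset of $(R,+)$, there is a solution of System $( * )$ with all variables taking values in $C$ and with distinct variables taking different values.
   Context: System $( * )$ is the infinite system of linear equations, in the unknowns $y_1,\ldots,y_\alpha$ and $x_{n,j},z_n$ ($n\geq 2$, $1\leq j\leq n$), consisting of, for every $n\geq 2$, the equation $x_{n,1}+x_{n,2}+\cdots+x_{n,n}+d_{n,1}y_1+d_{n,2}y_2+\cdots+d_{n,\alpha}y_\alpha=z_n$. $\mathbb N$ denotes the positive integers. For a commutative semigroup $(S,+)$ with the discrete topology, $\beta S$ is the Stone–Čech compactification, whose points are the ultrafilters on $S$ (principal ultrafilters identified with points of $S$). The operation extends to $\beta S$ by: for $A\subseteq S$ and $p,q\in\beta S$, $A\in p+q$ iff $\{x\in S:-x+A\in q\}\in p$, where $-x+A=\{y\in S:x+y\in A\}$. With this, $\beta S$ is a compact Hausdorff right topological semigroup; it has a smallest two-sided ideal $K(\beta S)$, and idempotents in $K(\beta S)$ are called minimal idempotents. A subset $A\subseteq S$ is central if it belongs to some minimal idempotent of $\beta S$, and central* if it belongs to every minimal idempotent of $\beta S$. *)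

(* Defs.v *)
From HB Require Import structures.
From mathcomp Require Import all_boot all_order all_algebra.
From mathcomp Require Import mathcomp_extra boolp classical_sets functions.
From mathcomp Require Import cardinality filter.

Set Implicit Arguments.
Unset Strict Implicit.
Unset Printing Implicit Defensive.

Import GRing.Theory.
Local Open Scope classical_set_scope.
Local Open Scope ring_scope.

(** [addSemigroupType] is MathComp's additive semigroup; its addition is
    commutative (and it need not have a zero). *)

Record beta (S : addSemigroupType) := Beta {
  ultra_sets : set_system S;
  ultra_setsP : UltraFilter ultra_sets
}.

(** The set [[set y | A (x + y)]] is [-x + A]. *)
Definition add_sets (S : addSemigroupType) (p q : set_system S) :
    set_system S :=
  [set A : set S | p [set x | q [set y | A (x + y)]]].

Lemma add_sets_ultra (S : addSemigroupType) (p q : set_system S) :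
  UltraFilter p -> UltraFilter q -> UltraFilter (add_sets p q).
Proof.
move=> pU qU.
have pqF : Filter (add_sets p q).
  split.
  - by apply: (@filterS _ p _ setT) => [x _|]; exact: filterT.
  - by move=> A B pA pB; apply: (@filterS2 _ p) pA pB => x; exact: filterI.
  - move=> A B AB; apply: (@filterS _ p) => x; apply: filterS => y; exact: AB.
have pqP : ProperFilter (add_sets p q).
  split => // p0; have [x qx] := @filter_ex _ p _ _ p0.
  by have [] := filter_ex qx.
split => // G GP pqG; rewrite eqEsubset; split => // A GA.
have [//|pAC] := in_ultra_setVsetC [set x | q [set y | A (x + y)]] pU.
suff /pqG GAC : add_sets p q (~` A) by have [? []] := filter_ex (filterI GA GAC).
apply: (@filterS _ p) pAC => x /= nqA.
by have [] := in_ultra_setVsetC [set y | A (x + y)] qU.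
Qed.

Definition beta_add (S : addSemigroupType) (p q : beta S) : beta S :=
  Beta (add_sets_ultra (ultra_setsP p) (ultra_setsP q)).

Definition two_sided_ideal (S : addSemigroupType) (I : set (beta S)) : Prop :=
  I !=set0 /\
  forall p q : beta S, I p -> I (beta_add p q) /\ I (beta_add q p).

(** The smallest two-sided ideal [K(beta S)], as the intersection of all
    (nonempty) two-sided ideals. *)
Definition smallest_ideal (S : addSemigroupType) : set (beta S) :=
  \bigcap_(I in [set I | two_sided_ideal I]) I.

Definition minimal_idempotent (S : addSemigroupType) (p : beta S) : Prop :=
  beta_add p p = p /\ smallest_ideal p.

Definition central (S : addSemigroupType) (A : set S) : Prop :=
  exists2 p : beta S, minimal_idempotent p & ultra_sets p A.

Definition central_star (S : addSemigroupType) (A : set S) : Prop :=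
  forall p : beta S, minimal_idempotent p -> ultra_sets p A.

(** The index [j : 'I_n] of [x_{n,j}] and [i : 'I_alpha] of [y_i] start at 0. *)
Inductive star_var (alpha : nat) : Type :=
| Var_y (i : 'I_alpha)
| Var_x (n : nat) (n_ge2 : (2 <= n)%N) (j : 'I_n)
| Var_z (n : nat) (n_ge2 : (2 <= n)%N).

Arguments Var_y {alpha} i.
Arguments Var_x {alpha n} n_ge2 j.
Arguments Var_z {alpha n} n_ge2.

(** Only the coefficients [d n i] with [2 <= n] are used. *)
Definition star_solution (R : pzRingType) (alpha : nat)
    (d : nat -> 'I_alpha -> R) : set (star_var alpha -> R) :=
  [set v | forall (n : nat) (n_ge2 : (2 <= n)%N),
    \sum_(j < n) v (Var_x n_ge2 j) + \sum_(i < alpha) d n i * v (Var_y i)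
    = v (Var_z n_ge2)].

(** [sol] is the set of solutions, in the variables [V], of some system. *)
Definition strongly_centrally_partition_regular (R : pzRingType) (V : Type)
    (sol : set (V -> R)) : Prop :=
  forall C : set R, central C ->
    exists v : V -> R, [/\ sol v, forall x, C (v x) & injective v].

(* Main.v *)
(** Let [p] be a minimal idempotent containing [C]. The set [B] of all [g] with
    [-g + C] in [p] is syndetic and belongs to [p]; let [H] be the subgroup it
    spans. Finitely many translates of [B] cover [R], so [H] contains [r R] for
    some [r > 0]. Put [A = C] intersected with [H]. Differences of elements of
    [B] are differences of elements of [A] in many ways, hence every element of
    [H] is a sum of [k] elements of [A] minus a sum of [k] others; with the
    syndeticity of [B] this yields [n0] such that for [n >= n0] every element
    of [H] has the form [z - x_1 - ... - x_n] in [A]. So all equations with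
    [n >= n0] are solvable as soon as the [y_i] lie in [r R], a central* set.
    For the finitely many [n < n0], the [y_i] and then [x_{n,2}, ..., x_{n,n}]
    are chosen one by one, keeping the set of [a] in [A] with [a + s] in [A]
    piecewise syndetic, where [s] is the partial sum of the left hand side:
    for any idempotent [e] this persists for [e]-many increments of [s]. *)

Require Import Defs.
From HB Require Import structures.
From mathcomp Require Import all_boot all_order all_algebra.
From mathcomp Require Import mathcomp_extra boolp classical_sets functions.
From mathcomp Require Import cardinality filter.
From mathcomp Require Import zify.

Set Implicit Arguments.
Unset Strict Implicit.
Unset Printing Implicit Defensive.

Import GRing.Theory.
Local Open Scope classical_set_scope.
Local Open Scope ring_scope.

(** * Ultrafilters, minimal left ideals and the smallest ideal *)

Lemma ultraS_eq (T : Type) (p q : set_system T) :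
  UltraFilter p -> UltraFilter q -> p `<=` q -> p = q.
Proof. by move=> pU qU pq; rewrite (@max_filter _ _ pU q _ pq). Qed.

Lemma ultraC (T : Type) (p : set_system T) (A : set T) :
  UltraFilter p -> ~ p A -> p (~` A).
Proof. by move=> pU npA; case: (in_ultra_setVsetC A pU). Qed.

Lemma filter_disjoint (T : Type) (p : set_system T) (A : set T) :
  ProperFilter p -> p A -> ~ p (~` A).
Proof. by move=> pF pA pC; have [? []] := filter_ex (filterI pA pC). Qed.

Lemma add_setsA (S : nmodType) (p q r : set_system S) :
  add_sets p (add_sets q r) = add_sets (add_sets p q) r.
Proof.
apply/funext => A; congr (p _); apply/funext => x; congr (q _).
by apply/funext => y; congr (r _); apply/funext => z /=; rewrite addrA.
Qed.

(** Says that [p] lies in a minimal left ideal of [beta S]. *)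
Definition recurrent (S : nmodType) (p : set_system S) : Prop :=
  forall q : set_system S, UltraFilter q ->
    exists2 r : set_system S, UltraFilter r & add_sets r (add_sets q p) = p.

(** These filters correspond to the closed left ideals of [beta S], a maximal
    filter to a minimal left ideal. *)
Definition invariant_filter (S : nmodType) (F : set_system S) : Prop :=
  ProperFilter F /\ forall (x : S) (A : set S), F A -> F [set y | A (x + y)].

Lemma maximal_invariant_filter (S : nmodType) : inhabited S ->
  exists2 F : set_system S, invariant_filter F &
    forall F', invariant_filter F' -> F `<=` F' -> F' = F.
Proof.
move=> [x0].
have T_inv : invariant_filter [set [set: S]].
  split; last by move=> x A ->.
  split; first by move=> /seteqP[_ /(_ x0)]; exact.
  split=> //; first by move=> A B -> ->; rewrite setTI.
  by move=> A B AB eA; apply/seteqP; split=> // x _; apply: AB; rewrite eA.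
pose P F := F = set0 \/ @invariant_filter S F.
have [F [PF Fmax]] : exists F, P F /\ forall F', F `<` F' -> ~ P F'.
  apply: Zorn_bigcup => C CP Ctot.
  have [/eqP|/set0P[A0 [F0 CF0 F0A0]]] := eqVneq (\bigcup_(X in C) X) set0.
    by move=> /eqP ->; left.
  right.
  have inv F A : C F -> F A -> invariant_filter F.
    by move=> CF FA; case: (CP _ CF) => // F_eq; rewrite F_eq in FA.
  have F0_inv := inv _ _ CF0 F0A0; split; last first.
    move=> x A [F CF FA]; have [_ Fi] := inv _ _ CF FA.
    by exists F => //; exact: Fi.
  split.
    by move=> [F CF F_0]; have [[/(_ F_0)]] := inv _ _ CF F_0.
  split.
  - by exists F0 => //; have [? _] := F0_inv; exact: filterT.
  - move=> A B [F CF FA] [F' CF' FB].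
    have [[_ FF] _] := inv _ _ CF FA; have [[_ FF'] _] := inv _ _ CF' FB.
    by have [FF'S|F'FS] := Ctot _ _ CF CF'; [exists F'|exists F] => //;
      apply: filterI => //; [exact: FF'S|exact: F'FS].
  - move=> A B AB [F CF FA]; have [? _] := inv _ _ CF FA.
    by exists F => //; exact: filterS FA.
have F_inv : invariant_filter F.
  case: PF => // F_eq; case: (Fmax _ _ (or_intror T_inv)).
  by rewrite F_eq; split=> // /(_ [set: S] erefl).
exists F => // F' F'_inv FF'; apply: contrapT => nF.
apply: (Fmax F') (or_intror F'_inv); split=> // F'F; apply: nF.
by apply/seteqP; split.
Qed.

(** Any ultrafilter [p] above a maximal invariant filter [F] works. The sets with all translates in
    [w = q + p] form an invariant filter above [F], hence [F] itself. If [Z A] were empty with [A]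
    in [p], the complement of [A] would be in [F]. So the sets [Z A] generate a proper filter, and
    [r] above it has [r + w = p]. *)
Lemma recurrent_exists (S : nmodType) : inhabited S ->
  exists2 p : set_system S, UltraFilter p & recurrent p.
Proof.
move=> /maximal_invariant_filter[F [F_filter F_inv] F_max].
have [p [pU Fp]] := ultraFilterLemma F_filter.
exists p => // q qU; pose w := add_sets q p.
have wU : UltraFilter w := add_sets_ultra qU pU.
pose W : set_system S := [set A | forall x, w [set y | A (x + y)]].
have Fw : F `<=` w.
  move=> A FA; apply: (@filterS _ q _ setT) filterT => x _ /=.
  exact/Fp/F_inv.
have FW : F = W.
  apply/esym/F_max.
    split; last by move=> x A WA z; apply: filterS (WA (x + z)) => y /=; rewrite addrA.
    split; first by have [x _] := filter_ex (filterT : F setT);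
      move=> /(_ x) => w0; have [y []] := filter_ex w0.
    split.
    - by move=> x; apply: filterS filterT.
    - by move=> A B WA WB x; exact: filterI (WA x) (WB x).
    - by move=> A B AB WA x; apply: filterS (WA x) => y; exact: AB.
  by move=> A FA x; exact/Fw/F_inv.
pose Z (A : set S) := [set x | w [set y | A (x + y)]].
have [r [rU Br]] : exists r, UltraFilter r /\
    [set X : set S | exists2 A, p A & Z A `<=` X] `<=` r.
  apply: ultraFilterLemma; split.
    move=> [A pA ZA0]; apply: (filter_disjoint _ pA); apply: Fp.
    rewrite FW => x; rewrite [X in w X](_ : _ = ~` [set y | A (x + y)]) //.
    by apply: ultraC => wA; exact: (ZA0 x).
  split.
  - by exists setT; [exact: filterT|].
  - move=> X Y [A pA AX] [B pB BY]; exists (A `&` B); first exact: filterI.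
    move=> x ZAB; split; first by apply: AX; apply: filterS ZAB => y [].
    by apply: BY; apply: filterS ZAB => y [].
  - by move=> X Y XY [A pA AX]; exists A => //; exact: subset_trans XY.
exists r => //; apply/esym/ultraS_eq => //; first exact: add_sets_ultra.
by move=> A pA; apply: Br; exists A.
Qed.

(** The recurrent ultrafilters form a two-sided ideal. *)
Lemma smallest_ideal_recurrent (S : nmodType) (p : beta S) :
  smallest_ideal p -> recurrent (ultra_sets p).
Proof.
move=> pK; apply: (pK [set q | recurrent (ultra_sets q)]); split.
  have pU := ultra_setsP p; have [x _] := filter_ex (filterT : ultra_sets p setT).
  have [q qU q_rec] := recurrent_exists (inhabits x).
  by exists (Beta qU).
move=> s t s_rec /=; split=> q qU.
  have [r rU rqs] := s_rec _ qU; exists r => //.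
  by rewrite !add_setsA -(add_setsA r q) rqs.
have [r rU rqts] := s_rec _ (add_sets_ultra qU (ultra_setsP t)).
exists (add_sets (ultra_sets t) r).
  exact: add_sets_ultra (ultra_setsP t) rU.
by rewrite -[in RHS]rqts -!add_setsA.
Qed.

(** * Syndeticity and nonprincipality *)

Section Syndetic.
Variable G : zmodType.
Implicit Types p q : set_system G.

(** Otherwise some ultrafilter [q] contains the complement of every translate of [B], whereas [A] in
    [p = r + (q + p)] puts some [-x + B] in [q]. *)
Lemma recurrent_syndetic p (A : set G) : UltraFilter p -> recurrent p -> p A ->
  exists F : seq G, forall g, exists2 f, f \in F & p [set y | A (g - f + y)].
Proof.
move=> pU p_rec pA; apply: contrapT => nsynd.
pose B := [set g | p [set y | A (g + y)]].
have [q [qU Bq]] : exists q, UltraFilter q /\ [set X : set G | exists F : seq G,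
    forall g, (forall f, f \in F -> ~ B (g - f)) -> X g] `<=` q.
  apply: ultraFilterLemma; split.
    move=> [F F0]; apply: nsynd; exists F => g; apply: contrapT => ng.
    by apply: (F0 g) => f fF Bgf; apply: ng; exists f.
  split.
  - by exists [::].
  - move=> X Y [E EX] [F FY]; exists (E ++ F) => g EF.
    by split; [apply: EX|apply: FY] => f fEF; apply: EF; rewrite mem_cat fEF ?orbT.
  - by move=> X Y XY [F FX]; exists F => g /FX /XY.
have [r rU rqp] := p_rec _ qU; rewrite -rqp in pA.
have [x qx] := @filter_ex _ r _ _ pA.
have : q (~` [set y | B (x + y)]).
  apply: Bq; exists [:: - x] => g /(_ (- x)); rewrite mem_head opprK addrC.
  by move=> /(_ isT).
apply: (@filter_disjoint _ q); apply: (@filterS _ q _ _ _ _ qx) => y.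
by apply: (@filterS _ p) => z /=; rewrite addrA.
Qed.

(** For [p] principal, the translates given by [recurrent_syndetic] are single points, and finitely
    many cannot cover [G]. *)
Lemma recurrent_nonprincipal p (x : G) : infinite_set [set: G] ->
  UltraFilter p -> recurrent p -> p (~` [set x]).
Proof.
move=> Ginf pU p_rec; apply: ultraC => px; apply: Ginf.
have [F FG] := recurrent_syndetic pU p_rec px.
apply: (sub_finite_set _ (finite_seq F)) => g _ /=.
have [f fF pf] := FG g; have [y [/= ygf yx]] := filter_ex (filterI pf px).
suff -> : g = f by [].
by apply/eqP; rewrite -subr_eq0; apply/eqP/(addIr y); rewrite add0r ygf yx.
Qed.

Lemma nonprincipal_seq p (E : seq G) : Filter p ->
  (forall x, p (~` [set x])) -> p [set x | x \notin E].
Proof.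
move=> pF p1; elim: E => [|e E IH]; first by apply: filterS filterT.
apply: filterS2 (p1 e) IH => x /= /eqP xe xE.
by rewrite inE negb_or xe.
Qed.

End Syndetic.

(** * Large sets and the greedy choice of summands *)

Section Large.
Variable G : zmodType.
Implicit Types p e : set_system G.

(** For recurrent [p], a form of piecewise syndeticity. *)
Definition large p (X : set G) : Prop := exists g, p [set y | X (g + y)].

(** Writing [r = e + p], some translate of [X] is in [r] because [p] lies in
    [beta G + r], and [e + r = r]. *)
Lemma large_translate p e (X : set G) : UltraFilter p -> recurrent p ->
  UltraFilter e -> add_sets e e = e -> large p X ->
  e [set s | large p (X `&` [set a | X (a + s)])].
Proof.
move=> pU p_rec eU ee [g pgX].
have [t tU tep] := p_rec _ eU.
have [x rxX] : exists x, add_sets e p [set y | X (g + (x + y))].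
  by rewrite -tep in pgX; have [x ?] := @filter_ex _ t _ _ pgX; exists x.
have erX : add_sets e (add_sets e p) [set y | X (g + (x + y))].
  by rewrite add_setsA ee.
apply: (@filterS _ e _ _ _ _ erX) => s sX.
have rF := add_sets_ultra eU pU.
have [y pX] := @filter_ex _ e _ _ (filterI rxX sX).
exists (g + x + y); apply: (@filterS _ p _ _ _ _ pX).
move=> z [/= Xz Xsz]; split; first by rewrite -!addrA.
by rewrite -!addrA (addrA y z s) (addrC _ s).
Qed.

(** The invariant of the greedy choice: [s] is a partial left hand side, and many pairs [a], [a + s]
    in [A] remain for the last [x] and [z]. *)
Definition returns p (A : set G) (s : G) : Prop :=
  large p (A `&` [set a | A (a + s)]).

Lemma returns0 p A : Filter p -> p A -> returns p A 0.
Proof.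
by move=> pF pA; exists 0; apply: filterS pA => y Ay; split; rewrite /= ?addr0 add0r.
Qed.

Lemma returns_add p e A s : UltraFilter p -> recurrent p ->
  UltraFilter e -> add_sets e e = e -> returns p A s ->
  e [set t | returns p A (s + t)].
Proof.
move=> pU p_rec eU ee /(large_translate pU p_rec eU ee).
apply: filterS => t [g pg]; exists g; apply: filterS pg => y.
by move=> [[Ay _] [_ /=]]; rewrite -addrA (addrC t).
Qed.

Lemma preimage_ultra (f : G -> G) p : UltraFilter p ->
  UltraFilter [set X | p (f @^-1` X)].
Proof.
move=> pU; have fF : Filter [set X | p (f @^-1` X)].
  split; first exact: (filterT : p setT).
    by move=> X Y pX pY; exact: (@filterI _ p _ _ _ pX pY).
  by move=> X Y XY; apply: (@filterS _ p) => x; exact: XY.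
have fP : ProperFilter [set X | p (f @^-1` X)].
  by split => // p0; have [] := @filter_ex _ p _ _ p0.
split => // F FF pF; apply/seteqP; split => // X FX; apply: contrapT => npX.
by apply: (filter_disjoint FF FX); apply: pF; exact: (@ultraC _ p _ pU npX).
Qed.

(** An additive map sends idempotents to idempotents, so [returns_add] applies with [e] the image of
    [p]. Here [f] will be multiplication by a coefficient. *)
Lemma returns_add_image p (f : G -> G) A s : {morph f : x y / x + y} ->
  UltraFilter p -> recurrent p -> add_sets p p = p -> returns p A s ->
  p [set y | returns p A (s + f y)].
Proof.
move=> fD pU p_rec pp.
apply: (returns_add pU p_rec (preimage_ultra f pU)).
apply/esym/ultraS_eq; try exact: preimage_ultra.
  by apply: add_sets_ultra; exact: preimage_ultra.
move=> X; rewrite /= -[in X in X -> _]pp /add_sets /=.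
by apply: filterS => x; apply: filterS => y /=; rewrite fD.
Qed.

Lemma ultra_seq p (A : set G) (E : seq G) : ProperFilter p ->
  (forall x, p (~` [set x])) -> p A -> exists2 x, A x & x \notin E.
Proof.
move=> pF p1 pA; have [x [? ?]] := filter_ex (filterI pA (nonprincipal_seq E pF p1)).
by exists x.
Qed.

(** The set [E] to be avoided makes representations of different elements
    disjoint, hence addable. *)
Definition represents (A : set G) (i j : nat) (h : G) : Prop :=
  forall E : seq G, exists us vs : seq G,
    [/\ size us = i, size vs = j, uniq (us ++ vs),
        {in us ++ vs, forall x, A x /\ x \notin E} &
        \sum_(x <- us) x - \sum_(x <- vs) x = h].

Lemma represents_sub (A A' : set G) i j h : A `<=` A' ->
  represents A i j h -> represents A' i j h.
Proof.
move=> AA' rep E; have [us [vs [? ? ? uvA ?]]] := rep E; exists us, vs; split => //.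
by move=> x /uvA[/AA'].
Qed.

(** All [x] but one are picked greedily, keeping the partial sum [t] in [returns]; a pair [a],
    [a + t] in [A] then gives the last [x] and [z]. As [2 <= n], there is a greedy pick, and it can
    make [t] nonzero, which separates [z] from the last [x]. *)
Lemma returns_represents p A s n : UltraFilter p -> recurrent p ->
  add_sets p p = p -> (forall x, p (~` [set x])) -> p A ->
  returns p A s -> (2 <= n)%N -> represents A 1 n s.
Proof.
move=> pU p_rec pp p1 pA; case: n => [//|n] s_ret n_gt0 E.
have [xs [szs us xsA xs_ret xs0]] : exists xs : seq G,
    [/\ size xs = n, uniq xs, {in xs, forall x, A x /\ x \notin E},
        returns p A (s + \sum_(x <- xs) x) & (0 < n)%N -> s + \sum_(x <- xs) x != 0].
  elim: n {n_gt0} => [|n [xs [szs us xsA xs_ret _]]].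
    by exists [::]; split => //; rewrite big_nil addr0.
  have pret := returns_add pU p_rec pU pp xs_ret.
  have [x [Ax x_ret]] := ultra_seq
    (- (s + \sum_(x <- xs) x) :: xs ++ E) _ p1 (filterI pA pret).
  rewrite inE mem_cat !negb_or => /and3P[x0 xxs xE].
  exists (x :: xs); split.
  - by rewrite /= szs.
  - by rewrite /= xxs.
  - by move=> y; rewrite inE => /predU1P[->//|/xsA].
  - by rewrite big_cons (addrC x) addrA.
  - by rewrite big_cons (addrC x) addrA addrC addr_eq0.
have {}xs0 := xs0 n_gt0; set t := s + _ in xs_ret xs0.
have [g pg] := xs_ret.
have [y [Ay Ayt]] := ultra_seq
  ([seq x - g | x <- xs ++ E] ++ [seq x - t - g | x <- xs ++ E]) _ p1 pg.
rewrite mem_cat negb_or => /andP[yE ytE].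
have gyE : g + y \notin xs ++ E.
  by apply: contra yE => gyE; apply/mapP; exists (g + y) => //; rewrite addrC addKr.
have gytE : g + y + t \notin xs ++ E.
  apply: contra ytE => gyE'; apply/mapP; exists (g + y + t) => //.
  by rewrite addrK addrC addKr.
exists [:: g + y + t], (g + y :: xs); split => //.
- by rewrite /= szs.
- move: gyE gytE; rewrite /= !inE !mem_cat !negb_or us => /andP[-> _] /andP[-> _].
  by rewrite -subr_eq0 addrC addKr xs0.
- move=> x; rewrite !inE => /or3P[/eqP->|/eqP->|/xsA //].
    by move: gytE; rewrite mem_cat negb_or => /andP[_ ->].
  by move: gyE; rewrite mem_cat negb_or => /andP[_ ->].
- rewrite big_seq1 big_cons opprD addrA; apply/eqP; rewrite subr_eq.
  by rewrite (addrC (g + y)) addrK.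
Qed.

End Large.

(** * The spanned subgroup and balanced representations *)

Section Subgroup.
Variable G : zmodType.
Implicit Types (A B : set G) (p : set_system G).

Definition subgroup_span B : set G :=
  [set g | forall K : set G, B `<=` K ->
    (forall x y, K x -> K y -> K (x - y)) -> K g].

Lemma sub_span B : B `<=` subgroup_span B.
Proof. by move=> b Bb K BK _; exact: BK. Qed.

Lemma spanB B x y :
  subgroup_span B x -> subgroup_span B y -> subgroup_span B (x - y).
Proof. by move=> Hx Hy K BK KB; apply: (KB); [exact: Hx|exact: Hy]. Qed.

Lemma spanN B x : subgroup_span B x -> subgroup_span B (- x).
Proof. by move=> Hx; rewrite -[- x]add0r -{1}(subrr x); apply: spanB => //; exact: spanB. Qed.

Lemma spanD B x y :
  subgroup_span B x -> subgroup_span B y -> subgroup_span B (x + y).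
Proof. by move=> Hx Hy; rewrite -[y]opprK; apply: spanB => //; exact: spanN. Qed.

Lemma span_sum B (s : seq G) : B 0 -> {in s, forall x, subgroup_span B x} ->
  subgroup_span B (\sum_(x <- s) x).
Proof.
move=> B0 sH; rewrite big_seq.
by apply: (big_ind (subgroup_span B)) => //; [exact: sub_span|exact: spanD].
Qed.

Lemma represents0 A : represents A 0 0 0.
Proof. by move=> E; exists [::], [::]; split=> //; rewrite !big_nil subrr. Qed.

Lemma representsN A i j h : represents A i j h -> represents A j i (- h).
Proof.
move=> rep E; have [us [vs [szu szv uvU uvA <-]]] := rep E.
exists vs, us; split=> //; first by rewrite uniq_catC.
  by move=> x; rewrite mem_cat orbC -mem_cat; exact: uvA.
by rewrite opprB.
Qed.

Lemma representsD A i j h i' j' h' : represents A i j h ->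
  represents A i' j' h' -> represents A (i + i') (j + j') (h + h').
Proof.
move=> rep rep' E; have [us [vs [szu szv uvU uvA <-]]] := rep E.
have [us' [vs' [szu' szv' uvU' uvA' <-]]] := rep' ((us ++ vs) ++ E).
have perm : perm_eq ((us ++ us') ++ vs ++ vs') ((us ++ vs) ++ us' ++ vs').
  by rewrite -!catA perm_cat2l perm_catCA perm_refl.
exists (us ++ us'), (vs ++ vs'); split.
- by rewrite size_cat szu szu'.
- by rewrite size_cat szv szv'.
- rewrite (perm_uniq perm) cat_uniq uvU uvU' andbT /=; apply/hasPn => x /uvA'[_].
  by rewrite mem_cat negb_or => /andP[].
- move=> x; rewrite (perm_mem perm) mem_cat => /orP[/uvA //|/uvA'[Ax]].
  by rewrite mem_cat negb_or => /andP[_].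
- by rewrite !big_cat /= opprD addrACA.
Qed.

(** * Representing the whole subgroup for all large [n] *)

Section Syndetic_in_subgroup.
Variables (p : set_system G) (A B : set G) (F : seq G).
Local Notation H := (subgroup_span B).
Hypotheses (pU : UltraFilter p) (p1 : forall x, p (~` [set x])).
Hypotheses (B0 : B 0) (pB : p B) (AH : A `<=` H).
Hypothesis BA : forall b, B b -> p [set y | A (b + y)].
Hypothesis FB : forall g, exists2 f, f \in F & B (g - f).

Lemma shift_notin (b : G) (E : seq G) :
  p [set y | b + y \notin E].
Proof.
apply: filterS (nonprincipal_seq [seq x - b | x <- E] _ p1) => y /=.
by apply: contra => byE; apply/mapP; exists (b + y) => //; rewrite addrC addKr.
Qed.

Lemma represents_diff b b' : B b -> B b' -> b' != b -> represents A 1 1 (b' - b).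
Proof.
move=> Bb Bb' bb' E.
have [y [[Aby bE] [Aby' bE']]] := filter_ex
  (filterI (filterI (BA Bb) (shift_notin b E))
           (filterI (BA Bb') (shift_notin b' E))).
exists [:: b' + y], [:: b + y]; split => //.
- by rewrite /= inE andbT (inj_eq (addIr y)).
- by move=> x; rewrite !inE => /orP[]/eqP ->.
- by rewrite !big_seq1 opprD addrACA subrr addr0.
Qed.

(** Balanced representations are stable under differences, and a nonzero [b] in [B] is the
    difference [b - 0] of elements of [B]. *)
Lemma span_represents h : H h -> exists k, represents A k k h.
Proof.
move=> /(_ [set h | exists k, represents A k k h]); apply.
  move=> b Bb.
  have [->|b0] := eqVneq b 0; first by exists 0; exact: represents0.
  by exists 1; rewrite -[b]subr0; exact: represents_diff.
move=> x y [k repx] [l repy].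
by exists (k + l)%N; apply: representsD => //; exact: representsN.
Qed.

(** Prepares [k]-term sums before it is known which [f] is needed, with one shift [v] for all. If
    [f] is the sum of [us] minus that of [vs], add the sum of [vs] to [v]: old sums are extended by
    [vs], and the one for [0] extended by [us] serves [f]. Hence the [0] in the list. *)
Lemma common_sums (Fs : seq G) : {in Fs, forall f, H f} ->
  exists k, forall E : seq G, exists v (M : seq G),
    [/\ H v, {in M, forall x, A x /\ x \notin E} &
        {in 0 :: Fs, forall f, exists l : seq G,
          [/\ size l = k, uniq l, {subset l <= M} & \sum_(x <- l) x = v + f]}].
Proof.
elim: Fs => [|f Fs IH] FsH.
  exists 0 => E; exists 0, [::]; split => //; first exact: sub_span.
  by move=> f; rewrite inE => /eqP ->; exists [::]; split=> //; rewrite big_nil addr0.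
have [|k kP] := IH; first by move=> x xF; apply: FsH; rewrite inE xF orbT.
have [m rep] := span_represents (FsH f (mem_head _ _)).
exists (m + k)%N => E; have [us [vs [szu szv uvU uvA usvs]]] := rep E.
have [v [M [Hv MA vF]]] := kP ((us ++ vs) ++ E).
have [us_uniq vs_uniq] : uniq us /\ uniq vs by move: uvU; rewrite cat_uniq => /and3P[].
have cat_uniqM ws l : uniq ws -> {subset ws <= us ++ vs} -> uniq l ->
    {subset l <= M} -> uniq (ws ++ l).
  move=> wsU wsuv lU lM; rewrite cat_uniq wsU lU andbT /=.
  apply/hasPn => x /lM /MA[_]; rewrite mem_cat negb_or => /andP[xuv _].
  by apply: contra xuv => /wsuv.
have cat_subM ws l : {subset ws <= us ++ vs} -> {subset l <= M} ->
    {subset ws ++ l <= (us ++ vs) ++ M}.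
  move=> wsuv lM x; rewrite mem_cat [in X in _ -> X]mem_cat.
  by move=> /orP[/wsuv ->|/lM ->]; rewrite ?orbT.
have us_sub : {subset us <= us ++ vs} by move=> x xu; rewrite mem_cat xu.
have vs_sub : {subset vs <= us ++ vs} by move=> x xu; rewrite mem_cat xu orbT.
exists (\sum_(x <- vs) x + v), ((us ++ vs) ++ M); split.
- by apply: spanD => //; apply: span_sum => // x /vs_sub /uvA[/AH].
- move=> x; rewrite mem_cat => /orP[/uvA//|/MA[Ax]].
  by rewrite mem_cat negb_or => /andP[_].
- have vsP g : g \in 0 :: Fs -> exists l : seq G, [/\ size l = (m + k)%N,
      uniq l, {subset l <= (us ++ vs) ++ M} &
      \sum_(x <- l) x = \sum_(x <- vs) x + v + g].
    move=> /vF[l [szl lU lM sum_l]]; exists (vs ++ l); split.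
    + by rewrite size_cat szv szl.
    + exact: cat_uniqM.
    + exact: cat_subM.
    + by rewrite big_cat /= sum_l addrA.
  move=> g; rewrite !inE orbCA => /predU1P[->|gF]; last by apply: vsP; rewrite inE.
  have [l [szl lU lM sum_l]] := vF 0 (mem_head _ _); exists (us ++ l); split.
  + by rewrite size_cat szu szl.
  + exact: cat_uniqM.
  + exact: cat_subM.
  + by rewrite big_cat /= sum_l addr0 -usvs [RHS]addrC addrA subrK.
Qed.

Lemma ultra_uniq_seq n (E : seq G) : p A -> exists ws : seq G,
  [/\ size ws = n, uniq ws & {in ws, forall x, A x /\ x \notin E}].
Proof.
move=> pA; elim: n => [|n [ws [szw wsU wsA]]]; first by exists [::].
have [x Ax] := ultra_seq (ws ++ E) _ p1 pA.
rewrite mem_cat negb_or => /andP[xws xE]; exists (x :: ws).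
split; rewrite /= ?szw ?xws //.
by move=> y; rewrite inE => /predU1P[->|/wsA].
Qed.

(** The target is [h = (s + z) - (z + a + sum l + sum ws)], where [ws] is padding, [sum l = v + f]
    and [s] is in [B]; that is, [a + f = s - h']. Syndeticity gives [y = f0 + s] and
    [- h' - f0 = b f0 + f] with [f0], [f] in [F], so [a = b f0 + y] fits. *)
Lemma span_represents_large : exists n0, forall n h, (n0 <= n)%N -> H h ->
  represents A 1 n h.
Proof.
have pA : p A by apply: filterS (BA B0) => y; rewrite /= add0r.
have pH : p H by apply: filterS pB; exact: sub_span.
have pforall (P : G -> set G) : (forall f, H f -> p (P f)) ->
    p [set y | {in F, forall f, H f -> P f y}].
  move=> pP; elim: F => [|f Fs IH]; first by apply: filterS filterT.
  have [Hf|nHf] := pselect (H f).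
    apply: filterS2 (pP f Hf) IH => y Pfy IHy g; rewrite inE => /predU1P[->//|].
    exact: IHy.
  by apply: filterS IH => y IHy g; rewrite inE => /predU1P[->//|]; exact: IHy.
pose FH := [seq f <- F | `[< H f >]].
have [|k kP] := @common_sums FH.
  by move=> f; rewrite mem_filter => /andP[/asboolP].
(* The [2] counts [z] and [a] beside the [k] terms of [l]. *)
exists (k + 2)%N => n h kn Hh E.
have [ws [szw wsU wsA]] := ultra_uniq_seq (n - (k + 2)) E pA.
have [v [M [Hv MA vF]]] := kP (ws ++ E).
pose h' := h + \sum_(x <- ws) x + v.
have Hh' : H h'.
  by apply: spanD => //; apply: spanD => //; apply: span_sum => // x /wsA[/AH].
have /choice[b bP] : forall f0, exists b, B b /\ - h' - f0 - b \in F.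
  move=> f0; have [f fF Bf] := FB (- h' - f0).
  by exists (- h' - f0 - f); split; rewrite // opprB addrC subrK.
pose E' := ws ++ M ++ E.
(* Since [f0] will depend on [y], this [y] must suit all [f0] at once; [y != f0] makes [s] nonzero,
   so [s + z] differs from [z]. *)
have py : p [set y | {in F, forall f0, H f0 ->
    (A (b f0 + y) /\ b f0 + y \notin E') /\ - f0 + y \notin [:: 0]}].
  apply: pforall => f0 Hf0; have [Bb _] := bP f0; apply: filterI.
    by apply: filterI; [exact: BA|exact: shift_notin].
  exact: shift_notin.
have [y [Hy yP]] := filter_ex (filterI pH py).
have [f0 f0F Bs] := FB y.
have Hf0 : H f0 by rewrite -[f0](subKr y); apply: spanB => //; exact: sub_span.
have [[Aa aE'] s0] := yP f0 f0F Hf0; have [Bb fF] := bP f0.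
set a := b f0 + y in Aa aE'; set f := _ - b f0 in fF.
have Hf : H f.
  by apply: spanB (sub_span Bb); apply: spanB Hf0; exact: spanN.
have [l [szl lU lM sum_l]] : exists l : seq G, [/\ size l = k, uniq l,
    {subset l <= M} & \sum_(x <- l) x = v + f].
  by apply: vF; rewrite inE mem_filter fF andbT; apply/orP; right; exact/asboolP.
set s := y - f0 in Bs; have {}s0 : s != 0 by rewrite inE addrC in s0.
have [z [[Asz szE] [Az zE]]] := filter_ex
  (filterI (filterI (BA Bs) (shift_notin s (a :: E')))
           (filterI pA (nonprincipal_seq (a :: E') _ p1))).
exists [:: s + z], (z :: a :: l ++ ws); split => //.
- by rewrite /= size_cat szl szw; lia.
- have notinE' x : x \notin E' -> x \notin l ++ ws.
    apply: contra; rewrite /E' !mem_cat => /orP[/lM->|->//]; rewrite ?orbT //.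
  move: szE zE => /=; rewrite !inE !negb_or => /andP[sza /notinE' szlw] /andP[za /notinE' zlw].
  rewrite sza szlw za zlw notinE' // cat_uniq lU wsU /= !andbT.
  rewrite -subr_eq0 addrK s0 /=; apply/hasPn => x xws; apply/negP => /lM /MA[_].
  by rewrite mem_cat xws.
- have notinE x : x \notin a :: E' -> x \notin E.
    by apply: contra; rewrite /E' inE !mem_cat => ->; rewrite !orbT.
  move=> x; rewrite !inE mem_cat.
  move=> /or4P[/eqP->|/eqP->|/eqP->|/orP[/lM/MA[Ax]|/wsA//]].
  + by split=> //; exact: notinE.
  + by split=> //; exact: notinE.
  + by split=> //; apply: contra aE'; rewrite /E' !mem_cat => ->; rewrite !orbT.
  + by rewrite mem_cat negb_or => /andP[_].
- have af : a + f = s - h'.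
    by rewrite /a /f /s addrC [X in X = _]addrA subrK addrC (addrC (- h')) addrA.
  rewrite big_seq1 !big_cons big_cat /= sum_l opprD addrA addrK.
  apply/eqP; rewrite subr_eq (addrAC v) (addrCA a) af addrA (addrC v) (addrA h).
  by rewrite -/h' addrC subrK.
Qed.

End Syndetic_in_subgroup.
End Subgroup.
(** By pigeonhole, two of the multiples [x *+ i] with [i <= size F] lie in the same translate of
    [B]. The difference of their indices is at most [size F], so it divides the factorial, which
    does not depend on [x]. *)
Lemma span_mulrn (G : zmodType) (B : set G) (F : seq G) :
  (forall g, exists2 f, f \in F & B (g - f)) ->
  exists2 r, (0 < r)%N & forall x, subgroup_span B (x *+ r).
Proof.
move=> FB; exists (size F)`!; first exact: fact_gt0.
move=> x.
have /choice[f fP] : forall i : 'I_(size F).+1, exists f, f \in F /\ B (x *+ i - f).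
  by move=> i; have [f fF Bf] := FB (x *+ i); exists f.
have f_lt i : (index (f i) F < size F)%N by rewrite index_mem; case: (fP i).
have /injectivePn[i [j ij fij]] : ~~ injectiveb (fun i => Ordinal (f_lt i)).
  by apply/negP => /injectiveP/leq_card; rewrite !card_ord ltnn.
have {}fij : f i = f j.
  have [[fi _] [fj _]] := (fP i, fP j).
  by rewrite -(nth_index 0 fi) -(nth_index 0 fj) (congr1 val fij : index _ _ = _).
have spanij (k l : 'I_(size F).+1) : f k = f l -> (k < l)%N ->
    subgroup_span B (x *+ (size F)`!).
  move=> fkl kl; have H0 : subgroup_span B 0.
    rewrite -(subrr (x *+ k - f k)).
    by apply: spanB; apply: (@sub_span _ B _ (fP k).2).
  have Hlk : subgroup_span B (x *+ (l - k)).
    rewrite mulrnBr; last exact: ltnW.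
    rewrite -[x *+ l](subrK (f l)) -[x *+ k](subrK (f k)) fkl opprD addrACA subrr addr0.
    rewrite -{2}fkl; exact: spanB (sub_span (fP l).2) (sub_span (fP k).2).
  have /dvdnP[q ->] : (l - k %| (size F)`!)%N.
    by apply: dvdn_fact; rewrite subn_gt0 kl /= (leq_trans (leq_subr _ _)) // -ltnS.
  rewrite mulnC mulrnA; elim: q => [|q IH] //; rewrite mulrS; exact: spanD.
have [lt|gt|/val_inj eq] := ltngtP i j; first exact: spanij lt.
  exact: spanij gt.
by rewrite eq eqxx in ij.
Qed.

(** * Choosing values for the variables *)

Section Star.
Variables (R : pzRingType) (alpha : nat) (d : nat -> 'I_alpha -> R).

(** Only finitely many [n] are involved, so [p]-many values of the next [y] suit all of them at
    once. *)
Lemma returns_linear_forms (p : set_system R) (A : set R) (n0 : nat) :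
  UltraFilter p -> recurrent p -> add_sets p p = p ->
  (forall x, p (~` [set x])) -> p A ->
  exists ys : seq R, [/\ size ys = alpha, uniq ys, {in ys, forall y, A y} &
    forall n, (n < n0)%N -> returns p A (\sum_(i < alpha) d n i * ys`_i)].
Proof.
move=> pU p_rec pp p1 pA.
(* Coefficients extended by [0], so that the induction on the length of [ys] needs no bound. *)
pose d' n i := if insub i is Some j then d n j else 0.
suff [ys [szys ysU ysA ysP]] : exists ys : seq R,
    [/\ size ys = alpha, uniq ys, {in ys, forall y, A y} &
    forall n, (n < n0)%N -> returns p A (\sum_(i < alpha) d' n i * ys`_i)].
  exists ys; split=> // n /ysP; congr (returns _ _ _).
  by apply: eq_bigr => i _; rewrite /d' valK.
suff : forall k, exists ys : seq R,
    [/\ size ys = k, uniq ys, {in ys, forall y, A y} &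
    forall n, (n < n0)%N -> returns p A (\sum_(i < k) d' n i * ys`_i)] by exact.
elim=> [|k [ys [szys ysU ysA ysP]]].
  by exists [::]; split => // n _; rewrite big_ord0; exact: returns0.
have py : p [set y | forall n : 'I_n0,
    returns p A (\sum_(i < k) d' n i * ys`_i + d' n k * y)].
  apply: filter_forall => n.
  exact: (returns_add_image (mulrDr (d' n k)) pU p_rec pp (ysP n (ltn_ord n))).
have [y [Ay yP] yys] := ultra_seq ys _ p1 (filterI pA py).
exists (rcons ys y); split.
- by rewrite size_rcons szys.
- by rewrite rcons_uniq yys.
- by move=> x; rewrite mem_rcons inE => /predU1P[->|/ysA].
- move=> n nn0; have := yP (Ordinal nn0).
  rewrite big_ord_recr /= nth_rcons szys ltnn eqxx; congr (returns _ _ (_ + _)).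
  by apply: eq_bigr => i _; rewrite nth_rcons szys ltn_ord.
Qed.

(** The equations are solved in increasing order of [n], each avoiding all values used before. *)
Lemma star_solution_exists (A : set R) (ys : seq R) :
  size ys = alpha -> uniq ys -> {in ys, forall y, A y} ->
  (forall n, (2 <= n)%N -> represents A 1 n (\sum_(i < alpha) d n i * ys`_i)) ->
  exists v, [/\ star_solution d v, forall x, A (v x) & injective v].
Proof.
move=> szys ysU ysA rep; pose sigma n := \sum_(i < alpha) d n i * ys`_i.
have /choice[c cP] : forall nE : nat * seq R, exists l : seq R,
    [/\ uniq l, {in l, forall x, A x /\ x \notin nE.2} & (2 <= nE.1)%N ->
     size l = nE.1.+1 /\ \sum_(j < nE.1) l`_j.+1 + sigma nE.1 = l`_0].
  move=> [n E] /=; have [n2|n2] := leqP 2 n; last by exists [::].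
  have [us [vs [szu szv uvU uvA usvs]]] := rep n n2 E.
  case: us szu uvU uvA usvs => [//|u [|//]] _ uvU uvA usvs; exists (u :: vs); split=> // _.
  split; first by rewrite /= szv.
  by rewrite /sigma -usvs big_seq1 (big_nth 0) big_mkord szv addrC subrK.
pose used := fix used n := if n is m.+1 then used m ++ c (m, used m) else ys.
(* Rows [0] and [1] are both [ys], so disjointness is claimed only when the later row has index at
   least [2]; no [key] points to row [1]. *)
pose row n := if (n < 2)%N then ys else c (n, used n).
have rowU n : uniq (row n).
  by rewrite /row; case: ifP => // _; have [] := cP (n, used n).
have rowA n : {in row n, forall x, A x}.
  rewrite /row; case: ifP => // _ x xr.
  by have [_ /(_ x xr)[]] := cP (n, used n).
have used_sub m n : (m <= n)%N -> {subset used m <= used n}.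
  move=> /subnKC <-; elim: (n - m)%N => [|k IH] x xm; first by rewrite addn0.
  by rewrite addnS /= mem_cat IH.
have row_disj m n x : (m < n)%N -> (2 <= n)%N -> x \in row m -> x \notin row n.
  move=> mn n2 xm; rewrite /row ltnNge n2 /=; apply/negP => xn.
  have [_ /(_ x xn)[_ /negP[]]] := cP (n, used n).
  apply: (used_sub _ _ mn); rewrite /= mem_cat; apply/orP.
  move: xm; rewrite /row; case: ifP => [_ xys|]; last by right.
  by left; exact: (used_sub 0).
have row_sz n : (2 <= n)%N -> size (row n) = n.+1.
  by move=> n2; rewrite /row ltnNge n2 /=; have [_ _ /(_ n2)[]] := cP (n, used n).
pose key (x : star_var alpha) := match x with
  | Var_y i => (0, nat_of_ord i) | Var_x n _ j => (n, j.+1) | Var_z n _ => (n, 0)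
  end%N.
have key_inj : injective key.
  move=> [i|n n2 j|n n2] [i'|n' n2' j'|n' n2'] //=.
  - by move=> [] /val_inj ->.
  - by move=> [e _]; exfalso; move: n2'; rewrite -e.
  - by move=> [e _]; exfalso; move: n2'; rewrite -e.
  - by move=> [e _]; exfalso; move: n2; rewrite e.
  - move=> [e]; case: n' / e n2' j' => n2' j' /val_inj ->.
    by rewrite (bool_irrelevance n2 n2').
  - by move=> [e _]; exfalso; move: n2; rewrite e.
  - by move=> [e]; case: n' / e n2' => n2'; rewrite (bool_irrelevance n2 n2').
have key_lt x : ((key x).2 < size (row (key x).1))%N.
  case: x => [i|n n2 j|n n2] /=; last by rewrite row_sz.
    by rewrite /row /= szys.
  by rewrite row_sz // ltnS.
have key_ge2 x : (key x).1 = 0%N \/ (2 <= (key x).1)%N.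
  by case: x => [i|n n2 j|n n2] /=; [left|right|right].
pose v x := (row (key x).1)`_(key x).2.
have v_row x : v x \in row (key x).1 by exact: mem_nth.
exists v; split.
- move=> n n2; have [_ _ /(_ n2)[_]] := cP (n, used n).
  rewrite /v /= /row /= ltnNge n2 /= => <-; congr (_ + _).
- by move=> x; exact: rowA (v_row x).
- move=> x y vxy; apply: key_inj.
  have key_le a b : v a = v b -> ~ ((key a).1 < (key b).1)%N.
    move=> vab ab; have [b0|b2] := key_ge2 b; first by rewrite b0 in ab.
    by have := row_disj _ _ _ ab b2 (v_row a); rewrite vab v_row.
  have kxy : (key x).1 = (key y).1.
    by have [/key_le|/key_le|//] := ltngtP (key x).1 (key y).1; rewrite vxy.
  rewrite [key x]surjective_pairing [key y]surjective_pairing kxy; congr (_, _).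
  apply/eqP; rewrite -(nth_uniq 0 _ _ (rowU (key y).1)) ?key_lt //.
    by rewrite -{1}kxy -/(v x) vxy.
  by rewrite -kxy key_lt.
Qed.

End Star.

(** * Combining large and small [n] for a given central set *)

Theorem theorem3p6 (R : pzRingType) (R_infinite : infinite_set [set: R])
    (mR_central_star : forall m : nat, (0 < m)%N ->
      central_star [set m%:R * r | r in [set: R]])
    (alpha : nat) (alpha_gt0 : (0 < alpha)%N) (d : nat -> 'I_alpha -> R) :
  strongly_centrally_partition_regular (star_solution d).
Proof.
move=> C [P P_min pC].
have [/(congr1 (@ultra_sets _)) PP /smallest_ideal_recurrent p_rec] := P_min.
have pU := ultra_setsP P; pose p := ultra_sets P.
have p1 x : p (~` [set x]) by exact: recurrent_nonprincipal.
pose B := [set g | p [set y | C (g + y)]].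
have pB : p B by rewrite /p -PP in pC.
have B0 : B 0 by apply: filterS pC => y; rewrite /= add0r.
have [F FB] := recurrent_syndetic pU p_rec pC.
have pH : p (subgroup_span B) by apply: filterS pB; exact: sub_span.
pose A := C `&` subgroup_span B.
have BA b : B b -> p [set y | A (b + y)].
  move=> Bb; apply: filterS (filterI (Bb : p _) pH) => y [Cby Hy].
  by split=> //; apply: spanD => //; exact: sub_span.
have AH : A `<=` subgroup_span B by move=> x [].
have [n0 n0P] := span_represents_large pU p1 B0 pB AH BA FB.
have [r r_gt0 Hr] := @span_mulrn R B F FB.
(* For [y = r x], each [d n i * y] equals [r (d n i * x)], which is in the span whatever the
   coefficient. *)
pose D := A `&` [set r%:R * x | x in [set: R]].
have pD : p D by apply: filterI; [exact: filterI|exact: mR_central_star].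
have [ys [szys ysU ysD ys_ret]] := returns_linear_forms d n0 pU p_rec PP p1 pD.
apply: (star_solution_exists szys ysU) => [y /ysD[[]] //|n n2].
have [n0n|nn0] := leqP n0 n.
  apply: represents_sub (n0P n _ n0n _); first by move=> x [].
  apply: (big_ind (subgroup_span B)) => [||i _]; [exact: sub_span|exact: spanD|].
  have /ysD[_ [x _ <-]] : ys`_i \in ys by rewrite mem_nth ?szys.
  by rewrite mulr_natl mulrnAr.
apply: (@represents_sub _ D) => [x [[]] //|].
exact: returns_represents (ys_ret n nn0) n2.
Qed.
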